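(* We have the $\mathrm{des}$-Wilf equivalence $\underline{134}2\overset{\mathrm{des}}{\sim}\underline{124}3$.
   Context: $\mathfrak{S}_n$ is the set of permutations of $\{1,\ldots,n\}$ in one-line notation, and $\mathrm{des}(\pi)=|\{i\in[n-1]:\pi_i>\pi_{i+1}\}|$. An occurrence of the pattern $\underline{abc}d$ (where $abcd\in\mathfrak{S}_4$) in $\pi$ is a subsequence $\pi_i\pi_{i+1}\pi_{i+2}\pi_j$ with $j>i+2$ order-isomorphic to $abcd$. $\mathfrak{S}_n(\omega)$ is the set of permutations in $\mathfrak{S}_n$ with no occurrence of $\omega$. $\omega\overset{\mathrm{des}}{\sim}\omega'$ means $|\{\pi\in\mathfrak{S}_n(\omega):\mathrm{des}(\pi)=m\}|=|\{\pi\in\mathfrak{S}_n(\omega'):\mathrm{des}(\pi)=m\}|$ for all $n\ge1$ and $m\ge0$. *)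

(* Defs.v *)
From mathcomp Require Import all_boot all_fingroup.

Set Implicit Arguments.
Unset Strict Implicit.
Unset Printing Implicit Defensive.

(* 'S_n is the group of permutations of {0, ..., n-1}; values are shifted by
   one so that the word is pi_1 ... pi_n, with letters in {1, ..., n}.
   Positions in the word are numbered from 0. *)
Definition oneline (n : nat) (pi : 'S_n) : seq nat :=
  [seq (pi i).+1 | i <- enum 'I_n].

Definition des (n : nat) (pi : 'S_n) : nat :=
  #|[set i : 'I_n.-1 | nth 0 (oneline pi) i.+1 < nth 0 (oneline pi) i]|.

Definition order_iso (u v : seq nat) : bool :=
  (size u == size v) &&
  [forall p : 'I_(size u), forall q : 'I_(size u),
     (nth 0 u p < nth 0 u q) == (nth 0 v p < nth 0 v q)].

(* The word [:: a; b; c; d] stands for the vincular pattern abcd with abc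
   underlined: the first three entries of an occurrence must be adjacent. *)
Definition occurs_at (n : nat) (pi : 'S_n) (w : seq nat) (i j : 'I_n) : bool :=
  let x := nth 0 (oneline pi) in
  (i.+2 < j) && order_iso [:: x i; x i.+1; x i.+2; x j] w.

Definition avoiders (n : nat) (w : seq nat) : {set 'S_n} :=
  [set pi : 'S_n | ~~ [exists i : 'I_n, exists j : 'I_n, occurs_at pi w i j]].

Definition des_Wilf_equiv (w w' : seq nat) : Prop :=
  forall n m : nat, 1 <= n ->
    #|[set pi in avoiders n w | des pi == m]| =
    #|[set pi in avoiders n w' | des pi == m]|.

(* Main.v *)
Require Import Defs.
From mathcomp Require Import all_boot all_fingroup.
From mathcomp Require Import zify.

Set Implicit Arguments.
Unset Strict Implicit.
Unset Printing Implicit Defensive.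

(* The Lehmer code c_i = #{j > i : pi_j < pi_i} turns both avoidance
   conditions into local ones: pi avoids 134-2 (resp. 124-3, abc underlined)
   iff c_i <= c_{i+1} <= c_{i+2} always forces c_i = c_{i+1}
   (resp. c_{i+1} = c_{i+2}), and the descents of pi are those of c.
   Reversing and complementing each maximal weakly increasing run b..a of c
   within the interval [b, a] exchanges the two conditions, fixes both ends of
   every run (hence the descents), and preserves the bounds c_i <= n - 1 - i,
   because these are tightest at the end of a run. *)

(** * Maximal weakly increasing runs of a sequence *)

Definition run_end (n : nat) (c : nat -> nat) (k : nat) : bool :=
  (n <= k.+1) || (c k.+1 < c k).

Fixpoint run_lo (d : pred nat) (k : nat) : nat :=
  if k is k'.+1 then if d k' then k else run_lo d k' else 0.

Definition run_hi (n : nat) (d : pred nat) (k : nat) : nat :=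
  k + find d (iota k (n - k)).

Definition mirror (n : nat) (d : pred nat) (k : nat) : nat :=
  run_lo d k + run_hi n d k - k.

(** For [k < n] the subtractions here and in [mirror] do not truncate, since [k] lies in its run and
    [c] is monotone on that run. *)
Definition flip_runs (n : nat) (c : nat -> nat) (k : nat) : nat :=
  let d := run_end n c in
  c (run_lo d k) + c (run_hi n d k) - c (mirror n d k).

Lemma run_lo_le d k : run_lo d k <= k.
Proof. by elim: k => //= k IH; case: ifP => // _; apply: leqW. Qed.

Lemma run_hi_ge n d k : k <= run_hi n d k.
Proof. exact: leq_addr. Qed.

Lemma run_hi_lt n c k : k < n -> run_hi n (run_end n c) k < n.
Proof.
move=> ltkn; rewrite /run_hi -ltn_subRL -{2}(size_iota k (n - k)) -has_find.
(* The last position always ends a run, so [find] never falls back to its default value. *)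
apply/hasP; exists n.-1; first by rewrite mem_iota; lia.
by rewrite /run_end; apply/orP; left; lia.
Qed.

Lemma run_hiS n (d : pred nat) k : k < n -> ~~ d k -> run_hi n d k.+1 = run_hi n d k.
Proof.
move=> ltkn dk; rewrite /run_hi -[n - k](@prednK _) ?subn_gt0 //=.
by rewrite (negbTE dk) -subnS addSnnS.
Qed.

Lemma run_hi_end n (d : pred nat) k : d k -> run_hi n d k = k.
Proof. by move=> dk; rewrite /run_hi; case: (n - k) => [|p] /=; rewrite ?dk addn0. Qed.

Lemma run_inside n (d : pred nat) k j :
  run_lo d k <= j < run_hi n d k -> ~~ d j.
Proof.
case/andP; case: (ltnP j k) => [ltjk lej _ | lekj _ ltj].
  elim: k ltjk lej => //= k IH; case: ifP => [_|/negbT dk]; first by lia.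
  by rewrite ltnS leq_eqVlt => /predU1P[-> //|]; apply: IH.
have ltf : j - k < find d (iota k (n - k)) by rewrite /run_hi in ltj; lia.
have := before_find 0 ltf; rewrite nth_iota ?subnKC // => [->//|].
by apply: leq_trans ltf _; rewrite -{2}(size_iota k (n - k)) find_size.
Qed.

Lemma run_const n (d : pred nat) a b i :
    b < n -> (forall j, a <= j < b -> ~~ d j) -> a <= i <= b ->
  run_lo d i = run_lo d a /\ run_hi n d i = run_hi n d a.
Proof.
move=> ltbn dP; elim: i => [|i IH] /andP[leai leib].
  by move: leai; rewrite leqn0 => /eqP->.
move: leai; rewrite leq_eqVlt => /predU1P[-> // | leai].
have di : ~~ d i by apply: dP; lia.
have [] := IH _; first by lia.
by rewrite /= (negbTE di) run_hiS //; apply: leq_trans leib (ltnW ltbn).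
Qed.

Lemma same_run n c k j (d := run_end n c) :
    k < n -> run_lo d k <= j <= run_hi n d k ->
  run_lo d j = run_lo d k /\ run_hi n d j = run_hi n d k.
Proof.
move=> ltkn lej; have dP := @run_inside n d k.
(* The run itself serves as the interval, so [j] and [k] are both compared with its left end. *)
have const i := @run_const n d _ _ i (run_hi_lt c ltkn) dP.
have [-> ->] := const _ lej.
by case: (const k) => [|<- <-]; rewrite ?run_lo_le ?run_hi_ge.
Qed.

Lemma run_nondecreasing n c k i j (d := run_end n c) :
  k < n -> run_lo d k <= i -> i <= j -> j <= run_hi n d k -> c i <= c j.
Proof.
move=> ltkn lei; elim: j => [|j IH] leij lej.
  by move: leij; rewrite leqn0 => /eqP->.
move: leij; rewrite leq_eqVlt => /predU1P[-> // | leij].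
apply: leq_trans (IH leij (ltnW lej)) _.
have : ~~ d j by apply: (@run_inside n d k); rewrite (leq_trans lei leij).
by rewrite /d /run_end negb_or -leqNgt => /andP[].
Qed.

(** * The flip: fixed ends, increments, descents, involutivity, bounds *)

Lemma flip_runs_end n c k : k < n -> run_end n c k -> flip_runs n c k = c k.
Proof.
by move=> ltkn dk; rewrite /flip_runs /mirror run_hi_end // addnK addKn.
Qed.

Lemma flip_runs_start n c k : run_end n c k -> flip_runs n c k.+1 = c k.+1.
Proof. by move=> dk; rewrite /flip_runs /mirror /= dk addKn addnK. Qed.

Lemma mirror_bounds n c k (d := run_end n c) : k < n ->
  run_lo d k <= mirror n d k <= run_hi n d k.
Proof. by have := run_lo_le d k; have := run_hi_ge n d k; rewrite /mirror; lia. Qed.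

(** Reversing and complementing lists the increments of a run in reverse order: the step of the flip
    at [k] is the step of [c] at [m]. The equation is additive to avoid truncated subtraction. *)
Lemma flip_runs_pair n c k (m := mirror n (run_end n c) k.+1) :
    k.+1 < n -> c k <= c k.+1 ->
  [/\ m.+1 = mirror n (run_end n c) k, m.+1 < n, c m <= c m.+1 &
      flip_runs n c k + c m.+1 = flip_runs n c k.+1 + c m].
Proof.
move=> ltkn cle; set d := run_end n c.
have dk : ~~ d k by rewrite /d /run_end; lia.
have ltkn' := ltnW ltkn.
have hiE := run_hiS ltkn' dk; have loE : run_lo d k.+1 = run_lo d k by rewrite /= (negbTE dk).
have lo_le := run_lo_le d k; have hi_ge := run_hi_ge n d k.+1.
have hi_lt := run_hi_lt c ltkn'.
have mE : m.+1 = mirror n d k by rewrite /m /mirror -/d loE hiE; rewrite hiE in hi_ge; lia.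
have /andP[mlo mhi] := mirror_bounds c ltkn'.
have /andP[m'lo m'hi] := mirror_bounds c ltkn.
have mle : c m <= c m.+1.
  by apply: (@run_nondecreasing n c k); rewrite -?/d -?loE -?mE // mE.
split=> //; first by rewrite mE; apply: leq_ltn_trans mhi hi_lt.
rewrite /flip_runs -/d loE hiE -/m -mE.
have : c m.+1 <= c (run_hi n d k).
  by apply: (run_nondecreasing ltkn'); rewrite -/d ?mE.
by lia.
Qed.

(** Inside a run the increments are permuted, hence stay nonnegative; at a run end both [k] and
    [k.+1] keep their values. *)
Lemma flip_runs_desc n c k : k.+1 < n ->
  (flip_runs n c k.+1 < flip_runs n c k) = (c k.+1 < c k).
Proof.
move=> ltkn; case: (ltnP (c k.+1) (c k)) => [clt|cle]; last first.
  by have [_ _] := flip_runs_pair ltkn cle; lia.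
have dk : run_end n c k by rewrite /run_end clt orbT.
by rewrite flip_runs_start // flip_runs_end ?(ltnW ltkn).
Qed.

Lemma flip_runs_asc n c k : k.+1 < n ->
  (flip_runs n c k <= flip_runs n c k.+1) = (c k <= c k.+1).
Proof. by move=> ltkn; rewrite leqNgt flip_runs_desc // -leqNgt. Qed.

Lemma eq_run_end n c c' :
    (forall k, k.+1 < n -> (c k.+1 < c k) = (c' k.+1 < c' k)) ->
  run_end n c =1 run_end n c'.
Proof. by move=> cE k; rewrite /run_end; case: (leqP n k.+1) => //= ltk; apply: cE. Qed.

(** Needed because the code of a permutation is matched with a flipped sequence only below [n]. *)
Lemma eq_flip_runs n c c' : (forall k, k < n -> c k = c' k) ->
  forall k, k < n -> flip_runs n c k = flip_runs n c' k.
Proof.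
move=> cE k ltkn; have dE : run_end n c =1 run_end n c'.
  by apply: eq_run_end => i lti; rewrite !cE // ltnW.
have loE i : run_lo (run_end n c') i = run_lo (run_end n c) i.
  by elim: i => //= i ->; rewrite dE.
have hiE i : run_hi n (run_end n c') i = run_hi n (run_end n c) i.
  by rewrite /run_hi (eq_find dE).
have lo_le := run_lo_le (run_end n c) k.
have hi_lt := run_hi_lt c ltkn.
by rewrite /flip_runs /mirror !loE !hiE !cE //; lia.
Qed.

(** Descents are preserved, so the flipped sequence has the same runs, and on each of them reversing
    and complementing twice cancels. *)
Lemma flip_runsK n c k : k < n -> flip_runs n (flip_runs n c) k = c k.
Proof.
move=> ltkn; pose d := run_end n c; pose d' := run_end n (flip_runs n c).
have dE : d' =1 d by apply: eq_run_end => i; apply: flip_runs_desc.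
have loE i : run_lo d' i = run_lo d i by elim: i => //= i ->; rewrite dE.
have hiE i : run_hi n d' i = run_hi n d i by rewrite /run_hi (eq_find dE).
have lo_le := run_lo_le d k; have hi_ge := run_hi_ge n d k.
have flipE j : run_lo d k <= j <= run_hi n d k ->
    flip_runs n c j =
      c (run_lo d k) + c (run_hi n d k) - c (run_lo d k + run_hi n d k - j).
  by move=> /(same_run ltkn)[loj hij]; rewrite /flip_runs /mirror loj hij.
rewrite {1}/flip_runs -/d' /mirror loE hiE !flipE; try lia.
have lec : c k <= c (run_hi n d k) by apply: (run_nondecreasing ltkn).
by rewrite !(addKn, addnK) !subKn //; lia.
Qed.

Lemma flip_runs_bound n c :
    (forall k, k < n -> c k + k < n) ->
  forall k, k < n -> flip_runs n c k + k < n.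
Proof.
move=> cP k ltkn; have /andP[mlo mhi] := mirror_bounds c ltkn.
have hi_lt := run_hi_lt c ltkn; have hi_ge := run_hi_ge n (run_end n c) k.
(* Hence the flipped value is at most [c] at the right end of the run, and [k] does not exceed that
   end. *)
have cle : c (run_lo (run_end n c) k) <= c (mirror n (run_end n c) k).
  exact: (run_nondecreasing ltkn).
by have := cP _ hi_lt; rewrite /flip_runs; lia.
Qed.

(** * Flatness conditions exchanged by the flip *)

Definition first_flat (n : nat) (c : nat -> nat) : Prop :=
  forall k, k.+2 < n -> c k <= c k.+1 <= c k.+2 -> c k = c k.+1.

Definition last_flat (n : nat) (c : nat -> nat) : Prop :=
  forall k, k.+2 < n -> c k <= c k.+1 <= c k.+2 -> c k.+1 = c k.+2.

(** Two overlapping uses of [flip_runs_pair]: the first step of a weakly increasing triple becomes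
    the last step of the mirrored triple, and conversely. *)
Lemma flip_runs_triple n c k (m := mirror n (run_end n c) k.+2) :
    k.+2 < n -> flip_runs n c k <= flip_runs n c k.+1 <= flip_runs n c k.+2 ->
  [/\ m.+2 < n, c m <= c m.+1 <= c m.+2,
      (c m == c m.+1) = (flip_runs n c k.+1 == flip_runs n c k.+2) &
      (c m.+1 == c m.+2) = (flip_runs n c k == flip_runs n c k.+1)].
Proof.
move=> ltkn; rewrite !flip_runs_asc ?(ltnW ltkn) // => /andP[c01 c12].
have [mE ltm cm01 E01] := flip_runs_pair ltkn c12.
have [] := flip_runs_pair (ltnW ltkn) c01; rewrite -mE -/m => _ ltm' cm12 E12.
rewrite -/m in E01 cm01; split=> //; first by rewrite cm01.
  by apply/eqP/eqP => eq_c; lia.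
by apply/eqP/eqP => eq_c; lia.
Qed.

Lemma flip_runs_first_flat n c :
  first_flat n c -> last_flat n (flip_runs n c).
Proof.
move=> cP k ltk /(flip_runs_triple ltk)[ltm cm E _].
by apply/eqP; rewrite -E (cP _ ltm cm).
Qed.

Lemma flip_runs_last_flat n c :
  last_flat n c -> first_flat n (flip_runs n c).
Proof.
move=> cP k ltk /(flip_runs_triple ltk)[ltm cm _ E].
by apply/eqP; rewrite -E (cP _ ltm cm).
Qed.

(** * The Lehmer code as a bijection *)

Definition lehmer (n : nat) (pi : 'S_n) (k : nat) : nat :=
  #|[set j : 'I_n | (k < j) &&
      (nth 0 (oneline pi) j < nth 0 (oneline pi) k)]|.

Lemma nth_oneline n (pi : 'S_n) (i : 'I_n) : nth 0 (oneline pi) i = (pi i).+1.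
Proof. by rewrite (nth_map i) ?nth_ord_enum // size_enum_ord. Qed.

Lemma size_oneline n (pi : 'S_n) : size (oneline pi) = n.
Proof. by rewrite size_map size_enum_ord. Qed.

Lemma oneline_uniq n (pi : 'S_n) : uniq (oneline pi).
Proof.
by rewrite map_inj_uniq ?enum_uniq // => i j [/val_inj/perm_inj].
Qed.

Lemma lehmer_ord n (pi : 'S_n) (i : 'I_n) :
  lehmer pi i = #|[set j : 'I_n | (i < j) && (pi j < pi i)]|.
Proof. by apply: eq_card => j; rewrite !inE !nth_oneline ltnS. Qed.

Lemma lehmer_bound n (pi : 'S_n) k : k < n -> lehmer pi k + k < n.
Proof.
move=> ltkn; suff: lehmer pi k <= n - k.+1 by lia.
have <- : #|[set j : 'I_n | k < j]| = n - k.+1.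
  rewrite -sum1dep_card -(big_geq_mkord k.+1 n xpredT (fun=> 1)).
  by rewrite sum_nat_const_nat muln1.
by apply/subset_leq_card/subsetP => j; rewrite !inE => /andP[].
Qed.

(* Counted by value: the letters below [pi i] that stand at position [i] or
   later are determined by [pi i] and the letters before position [i]. *)
Lemma lehmer_values n (pi : 'S_n) (i : 'I_n) :
  lehmer pi i = #|[set v : 'I_n | (i <= (pi^-1)%g v) && (v < pi i)]|.
Proof.
rewrite lehmer_ord -[RHS](card_preimset _ (@perm_inj _ pi)).
apply: eq_card => j; rewrite !inE permK.
by case: ltngtP => //= /val_inj->; rewrite ltnn.
Qed.

(** If [pi i < s i], every value counted for [pi] is counted for [s], since equal prefixes leave the
    same values available; [pi i] itself is counted only for [s], so the codes differ. *)
Lemma lehmer_first_diff n (pi s : 'S_n) (i : 'I_n) :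
    (forall j : 'I_n, j < i -> pi j = s j) -> lehmer pi i = lehmer s i ->
  s i <= pi i.
Proof.
move=> eq_lt eq_code; rewrite leqNgt; apply/negP => ltpi.
suff: lehmer pi i < lehmer s i by rewrite eq_code ltnn.
have piV v : i <= (pi^-1)%g v -> i <= (s^-1)%g v.
  apply: contraTT; rewrite -!ltnNge => ltv.
  by rewrite -{1}(permKV s v) -(eq_lt _ ltv) permK.
rewrite !lehmer_values; apply/proper_card/properP; split.
  apply/subsetP => v; rewrite !inE => /andP[/piV-> /= ltv].
  exact: ltn_trans ltpi.
by exists (pi i); rewrite !inE ?ltpi ?piV ?permK ?ltnn ?andbF.
Qed.

(** Strong induction on the position: once the prefixes agree, [lehmer_first_diff] applies in both
    directions. *)
Lemma lehmer_inj n (pi s : 'S_n) :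
  (forall k, k < n -> lehmer pi k = lehmer s k) -> pi = s.
Proof.
move=> eq_code; apply/permP => i.
have [m] := ubnP (val i); elim: m i => // m IH i ltim.
have eq_lt (j : 'I_n) : j < i -> pi j = s j.
  by move=> ltji; apply: IH; apply: leq_trans ltji ltim.
apply/val_inj/anti_leq/andP; split; apply: lehmer_first_diff.
- by move=> j ltj; rewrite eq_lt.
- by rewrite eq_code.
- exact: eq_lt.
- exact: eq_code.
Qed.

(** By counting: [code] is injective, and the bounded codes number [n!], as do the permutations. *)
Lemma lehmer_surj n (c : nat -> nat) : (forall k, k < n -> c k + k < n) ->
  exists pi : 'S_n, forall k, k < n -> lehmer pi k = c k.
Proof.
move=> cP; pose F (i : 'I_n) := [pred v : 'I_n.+1 | v + i < n].
(* The codomain ['I_n.+1] makes [inord] available even for [n = 0]. *)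
pose code (pi : 'S_n) : {ffun 'I_n -> 'I_n.+1} :=
    [ffun i : 'I_n => inord (lehmer pi i)].
have codeE pi (i : 'I_n) : code pi i = lehmer pi i :> nat.
  rewrite ffunE inordK // ltnS; have := lehmer_bound pi (ltn_ord i); lia.
have code_inj : injective code.
  move=> pi s eq_code; apply: lehmer_inj => k ltkn.
  by rewrite -(codeE pi (Ordinal ltkn)) -(codeE s (Ordinal ltkn)) eq_code.
have cardF : #|family F| = #|[set: 'S_n]|.
  rewrite card_family cardsT card_Sn foldrE big_map big_enum /=.
  transitivity (\prod_(i < n) (n - i)).
    apply: eq_bigr => i _; rewrite -sum1_card.
    rewrite (eq_bigl (fun v : 'I_n.+1 => v < n - i)); last first.
      by move=> v; rewrite ltn_subRL addnC.
    rewrite -(big_ord_widen n.+1 (fun=> 1)); last by rewrite leqW ?leq_subr.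
    by rewrite sum1_card card_ord.
  rewrite fact_prod big_add1 big_mkord (reindex_inj rev_ord_inj) /=.
  by apply: eq_bigr => i _; rewrite subKn.
have imF : code @: [set: 'S_n] =i family F.
  apply/subset_cardP; first by rewrite cardF card_imset.
  apply/subsetP => _ /imsetP[pi _ ->]; apply/familyP => i.
  by rewrite inE codeE lehmer_bound.
pose f : {ffun 'I_n -> 'I_n.+1} := [ffun i : 'I_n => inord (c i)].
have fE (i : 'I_n) : f i = c i :> nat.
  rewrite ffunE inordK // ltnS; have := cP _ (ltn_ord i); lia.
have /imsetP[pi _ eq_f] : f \in code @: [set: 'S_n].
  by rewrite imF; apply/familyP => i; rewrite inE fE cP.
exists pi => k ltkn.
by rewrite -(codeE pi (Ordinal ltkn)) -eq_f (fE (Ordinal ltkn)).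
Qed.

(** * Descents, ascents and gaps read from the code *)

(** At a descent, whatever is counted at [k.+1] is counted at [k], along with position [k.+1]
    itself. At an ascent that position is not counted at [k], which gives the opposite inclusion. *)
Lemma lehmer_desc n (pi : 'S_n) k : k.+1 < n ->
  (lehmer pi k.+1 < lehmer pi k) =
    (nth 0 (oneline pi) k.+1 < nth 0 (oneline pi) k).
Proof.
move=> ltkn; set x := nth 0 (oneline pi); case: (ltnP (x k.+1)) => [ltx|lex].
  apply/proper_card/properP; split; last first.
    by exists (Ordinal ltkn); rewrite !inE /= ?ltnSn ?ltnn.
  apply/subsetP => j; rewrite !inE => /andP[ltj ltxj].
  by rewrite (ltnW ltj) (ltn_trans ltxj).
apply/negbTE; rewrite -leqNgt; apply/subset_leq_card/subsetP => j.
rewrite !inE => /andP[ltj ltxj]; rewrite (leq_trans ltxj lex) andbT ltn_neqAle ltj andbT.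
by apply: contraTneq ltxj => <-; rewrite -leqNgt.
Qed.

(** At an ascent the set counted at [k] lies inside the one counted at [k.+1]; the difference
    consists of the later positions whose letters lie strictly between the two. *)
Lemma lehmer_eqP n (pi : 'S_n) k (x := nth 0 (oneline pi)) :
    k.+1 < n -> x k < x k.+1 ->
  reflect (forall j : 'I_n, k.+1 < j -> ~~ (x k < x j < x k.+1))
    (lehmer pi k == lehmer pi k.+1).
Proof.
move=> ltkn ltx.
pose A := [set j : 'I_n | (k < j) && (x j < x k)].
pose B := [set j : 'I_n | (k.+1 < j) && (x j < x k.+1)].
have sAB : A \subset B.
  apply/subsetP => j; rewrite !inE => /andP[ltj ltxj].
  rewrite (ltn_trans ltxj ltx) andbT ltn_neqAle ltj andbT.
  by apply: contraTneq ltxj => <-; rewrite -leqNgt ltnW.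
rewrite -[lehmer pi k]/#|A| -[lehmer pi k.+1]/#|B| (subset_leqif_cards sAB).
rewrite eqEsubset sAB /=; apply: (iffP subsetP) => [sBA j ltj|gap j].
  apply/negP => /andP[ltxk ltxj].
  have /sBA : j \in B by rewrite inE ltj.
  by rewrite inE => /andP[_]; rewrite ltnNge (ltnW ltxk).
rewrite !inE => /andP[ltj ltxj]; rewrite (ltnW ltj) /=.
have := gap j ltj; rewrite ltxj andbT -leqNgt leq_eqVlt => /orP[|//].
rewrite (nth_uniq _ _ _ (oneline_uniq pi)) ?size_oneline ?(ltnW ltkn) //.
by move=> /eqP eqjk; move: ltj; rewrite eqjk ltnNge leqnSn.
Qed.

Lemma lehmer_asc n (pi : 'S_n) k : k.+1 < n ->
  (lehmer pi k <= lehmer pi k.+1) =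
    (nth 0 (oneline pi) k < nth 0 (oneline pi) k.+1).
Proof.
move=> ltkn; rewrite leqNgt lehmer_desc // -leqNgt leq_eqVlt.
rewrite (nth_uniq _ _ _ (oneline_uniq pi)) ?size_oneline ?(ltnW ltkn) //.
by rewrite ltn_eqF.
Qed.

(** * Pattern avoidance as flatness of the code *)

Lemma order_iso4P (u0 u1 u2 u3 v0 v1 v2 v3 : nat)
    (u := [:: u0; u1; u2; u3]) (v := [:: v0; v1; v2; v3]) :
  reflect (forall p q, p < 4 -> q < 4 ->
             (nth 0 u p < nth 0 u q) = (nth 0 v p < nth 0 v q))
    (order_iso u v).
Proof.
apply: (iffP forallP) => [uv p q ltp ltq | uv p].
  by have /forallP/(_ (Ordinal ltq))/eqP := uv (Ordinal ltp).
by apply/forallP => q; apply/eqP/uv.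
Qed.

(** The comparisons are grouped so that the last is the gap condition of [lehmer_eqP] for the first
    two letters; in [order_iso1243] it concerns the second and third. *)
Lemma order_iso1342 a b c d :
  order_iso [:: a; b; c; d] [:: 1; 3; 4; 2] = [&& a < b, b < c & a < d < b].
Proof.
apply/order_iso4P/idP => [uv | /and3P[ab bc /andP[ad db]] p q].
  by rewrite (uv 0 1) ?(uv 1 2) ?(uv 0 3) ?(uv 3 1).
by move: p q => [|[|[|[|//]]]] [|[|[|[|//]]]] _ _ /=; lia.
Qed.

Lemma order_iso1243 a b c d :
  order_iso [:: a; b; c; d] [:: 1; 2; 4; 3] = [&& a < b, b < c & b < d < c].
Proof.
apply/order_iso4P/idP => [uv | /and3P[ab bc /andP[ad db]] p q].
  by rewrite (uv 0 1) ?(uv 1 2) ?(uv 1 3) ?(uv 3 2).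
by move: p q => [|[|[|[|//]]]] [|[|[|[|//]]]] _ _ /=; lia.
Qed.

Lemma avoidersP n w (pi : 'S_n) (x := nth 0 (oneline pi)) :
  reflect (forall k (j : 'I_n), k.+2 < j ->
             ~~ order_iso [:: x k; x k.+1; x k.+2; x j] w)
    (pi \in avoiders n w).
Proof.
rewrite inE; apply: (iffP existsPn) => [av k j ltkj | av i].
  have ltkn : k < n by have := ltn_ord j; lia.
  have /existsPn/(_ j) := av (Ordinal ltkn).
  by rewrite /occurs_at /= ltkj.
by apply/existsPn => j; rewrite /occurs_at; case: ltnP => //= /av.
Qed.

Lemma avoiders1342P n (pi : 'S_n) :
  pi \in avoiders n [:: 1; 3; 4; 2] <-> first_flat n (lehmer pi).
Proof.
set x := nth 0 (oneline pi).
split=> [/avoidersP av k ltkn | flat].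
  rewrite !lehmer_asc ?(ltnW ltkn) // => /andP[lt01 lt12].
  apply/eqP/(lehmer_eqP (ltnW ltkn) lt01) => j; rewrite leq_eqVlt.
  (* [lehmer_eqP] also asks about position [k.+2], which cannot be the fourth letter of an
     occurrence; its letter exceeds [x k.+1], so it lies outside the gap. *)
  case/predU1P => [<- | ltj]; first by rewrite [x _ < x k.+1]ltnNge (ltnW lt12) andbF.
  by have := av k j ltj; rewrite order_iso1342 lt01 lt12.
apply/avoidersP => k j ltj; have ltkn := ltn_trans ltj (ltn_ord j).
rewrite order_iso1342; apply/negP => /and3P[lt01 lt12].
apply/negP; apply: (lehmer_eqP (ltnW ltkn) lt01 _) (ltnW ltj).
by apply/eqP/flat; rewrite // !lehmer_asc ?lt01 ?(ltnW ltkn).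
Qed.

Lemma avoiders1243P n (pi : 'S_n) :
  pi \in avoiders n [:: 1; 2; 4; 3] <-> last_flat n (lehmer pi).
Proof.
split=> [/avoidersP av k ltkn | flat].
  rewrite !lehmer_asc ?(ltnW ltkn) // => /andP[lt01 lt12].
  apply/eqP/(lehmer_eqP ltkn lt12) => j ltj.
  by have := av k j ltj; rewrite order_iso1243 lt01 lt12.
apply/avoidersP => k j ltj; have ltkn := ltn_trans ltj (ltn_ord j).
rewrite order_iso1243; apply/negP => /and3P[lt01 lt12].
apply/negP; apply: (lehmer_eqP ltkn lt12 _) ltj.
by apply/eqP/flat; rewrite // !lehmer_asc ?lt01 ?(ltnW ltkn).
Qed.

(** * The induced involution on permutations *)

Lemma flip_runs_perm n : exists f : 'S_n -> 'S_n,
  forall pi k, k < n -> lehmer (f pi) k = flip_runs n (lehmer pi) k.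
Proof.
have ex_flip (pi : 'S_n) : exists s : 'S_n,
    forall k, k < n -> lehmer s k = flip_runs n (lehmer pi) k.
  by apply: lehmer_surj; apply: flip_runs_bound; apply: lehmer_bound.
exact: fin_all_exists ex_flip.
Qed.

Theorem theorem3p7 : des_Wilf_equiv [:: 1; 3; 4; 2] [:: 1; 2; 4; 3].
Proof.
move=> n m _; have [f fE] := flip_runs_perm n.
have fK : involutive f.
  move=> pi; apply: lehmer_inj => k ltkn; rewrite fE //.
  by rewrite (eq_flip_runs (fE pi)) // flip_runsK.
have des_f pi : des (f pi) = des pi.
  apply: eq_card => i; rewrite !inE; have lti : i.+1 < n by have := ltn_ord i; lia.
  by rewrite -!lehmer_desc // !fE ?flip_runs_desc // ltnW.
have av_f pi : (pi \in avoiders n [:: 1; 2; 4; 3]) =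
    (f pi \in avoiders n [:: 1; 3; 4; 2]).
  apply/idP/idP => [/avoiders1243P flat | /avoiders1342P flat].
    apply/avoiders1342P => k ltkn; rewrite !fE ?(ltnW ltkn, ltnW (ltnW ltkn)) //.
    exact: flip_runs_last_flat.
  (* Writing [pi] as [f (f pi)] exhibits its code as the flip of the code of [f pi]. *)
  rewrite -(fK pi); apply/avoiders1243P => k ltkn.
  rewrite !(fE (f pi)) ?(ltnW ltkn, ltnW (ltnW ltkn)) //.
  exact: flip_runs_first_flat.
(* The involution [f] pulls the first set back to the second. *)
rewrite -(card_preimset _ (inv_inj fK)).
by apply: eq_card => pi; have := av_f pi; rewrite !inE des_f => ->.
Qed.
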